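(* Let $E$, $F$ be archimedean Riesz spaces with positive cones $E^+$, $F^+$, let $m\in\mathbb{N}$, and let $f\colon E^+\to F^+$ be a mapping that satisfies (i) $\Delta^{m+1}f(x;h^{m+1})=0$ for all $x,h\in E^+$, and (ii) $\Delta^k f(x;h_1,\dots,h_k)\ge 0$ for all $x,h_1,\dots,h_k\in E^+$ and all $1\le k\le m$. Then $f$ extends to a unique positive polynomial $P\colon E\to F$ of degree $m$ or less.
   Context: Riesz spaces (vector lattices) are over the real numbers, $E^+=\{x\in E: x\ge 0\}$, and $\mathbb{N}=\{1,2,\dots\}$. Finite differences: for a mapping $f$ defined on $E^+$ and $x,h_1,\dots,h_n\in E^+$, $$\Delta^n f(x;h_1,\dots,h_n)=\sum_{\delta_1,\dots,\delta_n\in\{0,1\}}(-1)^{n-\sum\delta_i}f(x+\delta_1h_1+\dots+\delta_nh_n),$$ equivalently $\Delta f(x;h)=f(x+h)-f(x)$ and $\Delta^{n+1}f(x;h_1,\dots,h_{n+1})=\Delta\bigl(\Delta^nf(\,\cdot\,;h_1,\dots,h_n)\bigr)(x;h_{n+1})$. The notation $\Delta^nf(x;h^n)$ means $\Delta^nf(x;h,\dots,h)$ with $n$ equal increments $h$. For $k\ge 1$, a mapping $P_k\colon E\to F$ is a $k$-homogeneous polynomial if there is a $k$-linear (over $\mathbb{R}$) mapping $A_k\colon E^k\to F$ with $P_k(x)=A_k(x,\dots,x)$ for all $x\in E$; for $k=0$ it is a constant mapping, identified with its value $A_0\in F$. The mapping $A_k$ may be chosen symmetric, and the symmetric choice is uniquely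 determined by $P_k$. A polynomial of degree $m$ or less is a mapping $P=P_0+\dots+P_m$ with each $P_k$ a $k$-homogeneous polynomial (possibly zero); the components $P_k$ are uniquely determined by $P$. $P_k$ is positive if its symmetric generating mapping satisfies $A_k(x_1,\dots,x_k)\ge 0$ for all $x_1,\dots,x_k\ge 0$ in $E$ (for $k=0$: the constant is $\ge 0$), and $P$ is positive if each of its homogeneous components $P_k$ is positive. *)

(* Defs.v *)
From HB Require Import structures.
From mathcomp Require Import all_boot all_order all_fingroup all_algebra.
From mathcomp Require Import reals.

Set Implicit Arguments.
Unset Strict Implicit.
Unset Printing Implicit Defensive.

Import Order.TTheory GRing.Theory Num.Theory.
Local Open Scope ring_scope.

HB.mixin Record POrderedLmodule_isRiesz (R : realType) E
    of GRing.Lmodule R E & Num.POrderedZmodule E := {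
  riesz_lerD2r : forall z x y : E, x <= y -> x + z <= y + z;
  riesz_scaler_ge0 : forall (a : R) (x : E), 0 <= a -> 0 <= x -> 0 <= a *: x;
  riesz_meet : E -> E -> E;
  riesz_join : E -> E -> E;
  riesz_lexI : forall x y z : E, (x <= riesz_meet y z) = (x <= y) && (x <= z);
  riesz_leUx : forall x y z : E, (riesz_join x y <= z) = (x <= z) && (y <= z)
}.

(* The lattice operations are not inherited from [Order.Lattice]: in the
   library, [Num.RealDomain] is already a lattice and a [zmodType] without a
   named join of the two, so a new structure cannot inherit from both. *)
#[short(type="rieszType")]
HB.structure Definition Riesz (R : realType) :=
  { E of GRing.Lmodule R E & Num.POrderedZmodule E
         & POrderedLmodule_isRiesz R E }.

Definition riesz_archimedean (R : realType) (E : rieszType R) : Prop :=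
  forall x y : E, 0 <= x -> (forall n : nat, x *+ n <= y) -> x = 0.

Section PosCone.
Variables (R : realType) (E : rieszType R).

Definition riesz_nneg : pred E := fun x => 0 <= x.

Record pos_cone := PosCone {
  pos_cone_val :> E;
  pos_cone_valP : riesz_nneg pos_cone_val }.

HB.instance Definition _ := [isSub for pos_cone_val].
HB.instance Definition _ := [Choice of pos_cone by <:].

Fact riesz_nneg_addr_closed : addr_closed riesz_nneg.
Proof.
split=> [|x y]; rewrite !unfold_in /riesz_nneg //= => x0 y0.
apply: (le_trans y0); rewrite -{1}[y]add0r; exact: riesz_lerD2r.
Qed.

HB.instance Definition _ :=
  GRing.SubChoice_isSubNmodule.Build E riesz_nneg pos_cone
    riesz_nneg_addr_closed.

End PosCone.

Arguments pos_cone {R} E.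

(* [fdiff f x h] is $\Delta^n f(x; h_0, \dots, h_{n-1})$; the domain is only an
   additive monoid so that it can be a positive cone.  A boolean [d i] stands
   for $\delta_i \in \{0, 1\}$. *)
Definition fdiff (V : nmodType) (W : zmodType) (n : nat)
    (f : V -> W) (x : V) (h : 'I_n -> V) : W :=
  \sum_(d : {ffun 'I_n -> bool})
     f (x + \sum_(i < n) h i *+ d i) *~ (-1) ^+ (n - \sum_(i < n) d i)%N.

Lemma fdiff0 (V : nmodType) (W : zmodType) (f : V -> W) x (h : 'I_0 -> V) :
  fdiff f x h = f x.
Proof.
rewrite /fdiff (big_pred1 [ffun=> false]) => [|d].
  by rewrite !big_ord0 addr0 subn0 expr0.
by rewrite /=; apply/esym/eqP/ffunP; case.
Qed.

Lemma fdiffS (V : nmodType) (W : zmodType) n (f : V -> W) x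
    (h : 'I_n.+1 -> V) (h' := fun i : 'I_n => h (widen_ord (leqnSn n) i)) :
  fdiff f x h = fdiff f (x + h ord_max) h' - fdiff f x h'.
Proof.
pose ext (p : bool * {ffun 'I_n -> bool}) : {ffun 'I_n.+1 -> bool} :=
  [ffun i => oapp p.2 p.1 (insub (val i))].
pose res (d : {ffun 'I_n.+1 -> bool}) : bool * {ffun 'I_n -> bool} :=
  (d ord_max, [ffun i => d (widen_ord (leqnSn n) i)]).
have extw p i : ext p (widen_ord (leqnSn n) i) = p.2 i.
  by rewrite ffunE /= insubT //= => lt_in; congr (p.2 _); apply: val_inj.
have extm p : ext p ord_max = p.1 by rewrite ffunE /= insubF // ltnn.
have extK : cancel ext res.
  case=> b d; rewrite /res extm /=; congr pair.
  by apply/ffunP => i; rewrite ffunE extw.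
have resK : cancel res ext.
  move=> d; apply/ffunP => i; rewrite ffunE /=.
  case: insubP => [j _ ji|] /=.
    by rewrite ffunE; congr (d _); apply: val_inj; rewrite /= ji.
  rewrite -leqNgt => le_ni; congr (d _); apply: val_inj => /=.
  by apply/eqP; rewrite eqn_leq le_ni -ltnS ltn_ord.
rewrite /fdiff (reindex ext) /=; last by exists res => ? _.
pose G p := f (x + \sum_(i < n.+1) h i *+ ext p i)
  *~ (-1) ^+ (n.+1 - \sum_(i < n.+1) ext p i)%N.
rewrite (eq_bigr (fun p => G (p.1, p.2))) => [|[]//].
rewrite -(pair_bigA _ (fun b d => G (b, d))) /= big_bool; congr (_ + _).
  apply: eq_bigr => d _; rewrite /G !big_ord_recr /= !extm /= addn1 subSS.
  rewrite mulr1n [X in x + X]addrC addrA.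
  congr (f (_ + _) *~ _ ^+ (_ - _)%N); apply: eq_bigr => i _; by rewrite extw.
rewrite -sumrN; apply: eq_bigr => d _.
rewrite /G !big_ord_recr /= !extm /= addn0 mulr0n addr0.
under eq_bigr do rewrite extw.
under [X in (_ - X)%N]eq_bigr do rewrite extw.
rewrite subSn; last first.
  rewrite -[leqRHS]card_ord -sum1_card; apply: leq_sum => i _; exact: leq_b1.
by rewrite exprS mulN1r mulrNz.
Qed.

Section Polynomials.
Variables (R : realType) (E F : rieszType R).

Definition set_arg k (x : {ffun 'I_k -> E}) (i : 'I_k) (u : E) :
    {ffun 'I_k -> E} :=
  [ffun j => if j == i then u else x j].

Definition multilinear k (A : {ffun 'I_k -> E} -> F) : Prop :=
  forall (x : {ffun 'I_k -> E}) (i : 'I_k) (a : R) (u v : E),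
    A (set_arg x i (a *: u + v)) = a *: A (set_arg x i u) + A (set_arg x i v).

Definition symmetric_map k (A : {ffun 'I_k -> E} -> F) : Prop :=
  forall (s : 'S_k) (x : {ffun 'I_k -> E}), A [ffun i => x (s i)] = A x.

Definition generates k (A : {ffun 'I_k -> E} -> F) (P : E -> F) : Prop :=
  forall x : E, P x = A [ffun=> x].

(* There is a unique [x : {ffun 'I_0 -> E}], so for [k = 0] this says that [P]
   is constant. *)
Definition homogeneous_poly (k : nat) (P : E -> F) : Prop :=
  exists A : {ffun 'I_k -> E} -> F, multilinear A /\ generates A P.

(* The symmetric generating map is unique, so the existential quantifier merely
   names it. *)
Definition positive_homogeneous_poly (k : nat) (P : E -> F) : Prop :=
  exists A : {ffun 'I_k -> E} -> F,
    [/\ multilinear A, symmetric_map A, generates A P &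
        forall x : {ffun 'I_k -> E}, (forall i, 0 <= x i) -> 0 <= A x].

Definition homogeneous_components (m : nat) (P : E -> F)
    (Q : 'I_m.+1 -> E -> F) : Prop :=
  (forall k : 'I_m.+1, homogeneous_poly k (Q k)) /\
  (forall x : E, P x = \sum_(k < m.+1) Q k x).

(* Positive polynomials of degree at most [m].  The family [Q] of homogeneous
   components is determined by [P], so this existential quantifier, too, merely
   names it. *)
Definition positive_poly (m : nat) (P : E -> F) : Prop :=
  exists Q : 'I_m.+1 -> E -> F,
    homogeneous_components P Q /\
    forall k : 'I_m.+1, positive_homogeneous_poly k (Q k).

End Polynomials.

(* Main.v *)
(* Djokovic's identity, which can be arranged so that all increments stay in the
   cone, turns (i) into [fdiff f x h = 0] for arbitrary increments [h] in the
   cone, [m + 1] in number.  Then the diagonal [q] of the [m]-th difference of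
   [f] at [0], divided by [m!], is [m]-homogeneous over the naturals, the
   [m]-th differences of [f - q] vanish, and induction on [m] splits [f] into
   components [Q k].  The symmetric map generating [Q k] is [polar k (Q k)], the
   [k]-th difference of [Q k] at [0] divided by [k!]; it is additive in each
   variable on the cone.  Only [Q k, ..., Q m] contribute to the [k]-th
   difference of [f] at [0] with increments [h i / n]; multiplying it by [n ^ k]
   and letting [n] grow, the archimedean property of [F] and (ii) show that
   [polar k (Q k)] is nonnegative.  Positive additive maps into an archimedean
   space are homogeneous over the nonnegative reals, and extend from the cone
   through [x = x^+ - x^-]. *)

Require Import Defs.
From mathcomp Require Import all_boot all_order all_fingroup all_algebra.
From mathcomp Require Import reals boolp.
Import Order.TTheory GRing.Theory Num.Theory.
Local Open Scope ring_scope.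

Set Implicit Arguments.
Unset Strict Implicit.
Unset Printing Implicit Defensive.

(** * Alternating sums over the cube *)

(** A product over coordinates, so that flipping one coordinate changes one factor; [sgn_prodX]
    matches it with the sign in [fdiff]. *)
Definition sgn (n : nat) (d : {ffun 'I_n -> bool}) : int :=
  \prod_(i < n) (-1) ^+ (~~ d i).

Definition toggle (n : nat) (i : 'I_n) (d : {ffun 'I_n -> bool}) :
    {ffun 'I_n -> bool} :=
  [ffun j => if j == i then ~~ d j else d j].

Lemma toggleK n (i : 'I_n) : involutive (toggle i).
Proof.
by move=> d; apply/ffunP => j; rewrite !ffunE; case: eqP => // _; rewrite negbK.
Qed.

Lemma toggle_same n (i : 'I_n) d : toggle i d i = ~~ d i.
Proof. by rewrite ffunE eqxx. Qed.

Lemma toggle_neq n (i j : 'I_n) d : j != i -> toggle i d j = d j.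
Proof. by rewrite ffunE => /negbTE->. Qed.

Lemma sgn_toggle n (i : 'I_n) d : sgn (toggle i d) = - sgn d.
Proof.
rewrite /sgn (bigD1 i) //= [in RHS](bigD1 i) //= toggle_same.
under eq_bigr => j ji do rewrite toggle_neq//.
by rewrite -mulNr; case: (d i); rewrite ?expr0 ?expr1 // opprK.
Qed.

Lemma sgn_prodX n (d : {ffun 'I_n -> bool}) :
  sgn d = (-1) ^+ (n - \sum_(i < n) d i)%N.
Proof.
rewrite /sgn -expr_sum; congr (_ ^+ _).
have nE : (\sum_(i < n) (d i + ~~ d i))%N = n.
  by rewrite -[RHS]card_ord -sum1_card; apply: eq_bigr => i _; case: (d i).
by rewrite -[X in (X - _)%N]nE big_split addKn.
Qed.

Lemma sgn_const_false n :
  sgn ([ffun=> false] : {ffun 'I_n -> bool}) = (-1) ^+ n.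
Proof. by rewrite sgn_prodX big1 ?subn0 // => i _; rewrite ffunE. Qed.

(** Each vertex with [d i] true is paired with its neighbour across direction [i], which carries the
    opposite sign. *)
Lemma sum_sgn_split (W : zmodType) n (i : 'I_n)
    (G : {ffun 'I_n -> bool} -> W) :
  \sum_d G d *~ sgn d =
  \sum_(d : {ffun 'I_n -> bool} | d i) (G d - G (toggle i d)) *~ sgn d.
Proof.
rewrite (bigID (fun d : {ffun 'I_n -> bool} => d i)) /=.
rewrite [X in _ + X](reindex_inj (inv_inj (toggleK i))) /=.
under [X in _ + X]eq_bigl do rewrite toggle_same negbK.
by rewrite -big_split /=; apply: eq_bigr => d _;
  rewrite sgn_toggle mulrNz mulrzBl.
Qed.

(** * Finite differences *)

Section FiniteDifferences.
Variables (R : nzRingType) (V : nmodType) (W : lmodType R).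
Implicit Types (f : V -> W) (x : V).

Lemma fdiffE n f x (h : 'I_n -> V) :
  fdiff f x h =
  \sum_(d : {ffun 'I_n -> bool}) f (x + \sum_i h i *+ d i) *~ sgn d.
Proof. by apply: eq_bigr => d _; rewrite sgn_prodX. Qed.

Lemma eq_fdiffh n f x (h h' : 'I_n -> V) : h =1 h' ->
  fdiff f x h = fdiff f x h'.
Proof.
move=> hh; apply: eq_bigr => d _; congr (f (_ + _) *~ _).
by apply: eq_bigr => i _; rewrite hh.
Qed.

Lemma fdiff_cst0 n x (h : 'I_n -> V) : fdiff (fun=> 0 : W) x h = 0.
Proof. by rewrite /fdiff big1 // => d _; rewrite mul0rz. Qed.

Lemma fdiffB n f g x (h : 'I_n -> V) :
  fdiff (fun y => f y - g y) x h = fdiff f x h - fdiff g x h.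
Proof. by rewrite /fdiff -sumrB /=; apply: eq_bigr => d _; rewrite mulrzBl. Qed.

Lemma fdiffZ n (a : R) f x (h : 'I_n -> V) :
  fdiff (fun y => a *: f y) x h = a *: fdiff f x h.
Proof.
by rewrite /fdiff scaler_sumr; apply: eq_bigr => d _; rewrite scalerMzr. Qed.

Lemma fdiff_sum n I (r : seq I) (f : I -> V -> W) x (h : 'I_n -> V) :
  fdiff (fun y => \sum_(i <- r) f i y) x h = \sum_(i <- r) fdiff (f i) x h.
Proof.
rewrite /fdiff exchange_big /=; apply: eq_bigr => d _; rewrite mulrz_suml //.
Qed.

Lemma fdiff_shift n f x y (h : 'I_n -> V) :
  fdiff f (x + y) h = fdiff (fun z => f (z + y)) x h.
Proof. by apply: eq_bigr => d _; rewrite addrAC. Qed.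

Lemma fdiff_perm n f x (h : 'I_n -> V) (s : 'S_n) :
  fdiff f x (fun i => h (s i)) = fdiff f x h.
Proof.
pose t (u : 'S_n) (d : {ffun 'I_n -> bool}) := [ffun i => d (u i)].
have tK : cancel (t s) (t s^-1%g).
  by move=> d; apply/ffunP => i; rewrite !ffunE permKV.
rewrite /fdiff [LHS](reindex_inj (can_inj tK)) /=; apply: eq_bigr => d _.
congr (f (_ + _) *~ _ ^+ (_ - _)).
  by rewrite [RHS](reindex_inj (@perm_inj _ s)); apply: eq_bigr => i _;
    rewrite ffunE.
by rewrite [RHS](reindex_inj (@perm_inj _ s)); apply: eq_bigr => i _;
  rewrite ffunE.
Qed.

Lemma fdiff_scons n f x u (h : 'I_n -> V) :
  fdiff f (x + u) h - fdiff f x h =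
  fdiff f x (fun i : 'I_n.+1 => oapp h u (insub (val i))).
Proof.
rewrite [RHS]fdiffS /= insubF ?ltnn //=.
by congr (_ - _); apply: eq_fdiffh => i; rewrite /= insubT //= => lt_in;
  congr (h _); apply: val_inj.
Qed.

Lemma fdiffS_const n f x u :
  fdiff f x (fun _ : 'I_n.+1 => u) =
  fdiff (fun y => f (y + u) - f y) x (fun _ : 'I_n => u).
Proof. by rewrite fdiffS fdiff_shift fdiffB. Qed.

End FiniteDifferences.

(** * Order in Riesz spaces *)

Section RieszOrder.
Variables (R : realType) (E : rieszType R).
Implicit Types (x y z : E) (a b : R).

Lemma rz_subr_ge0 x y : (0 <= y - x) = (x <= y).
Proof.
apply/idP/idP => [/(riesz_lerD2r x)|/(riesz_lerD2r (- x))].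
  by rewrite add0r subrK.
by rewrite subrr.
Qed.

Lemma rz_addr_ge0 x y : 0 <= x -> 0 <= y -> 0 <= x + y.
Proof.
by move=> x0 y0; apply: (le_trans y0); rewrite -{1}[y]add0r;
  exact: riesz_lerD2r.
Qed.

Lemma rz_lerD x y z t : x <= y -> z <= t -> x + z <= y + t.
Proof.
move=> xy zt; apply: (le_trans (riesz_lerD2r z _ _ xy)).
by rewrite ![y + _]addrC; exact: riesz_lerD2r.
Qed.

Lemma rz_mulrn_ge0 x n : 0 <= x -> 0 <= x *+ n.
Proof. by move=> x0; elim: n => // n IH; rewrite mulrS rz_addr_ge0. Qed.

Lemma rz_sumr_ge0 I (r : seq I) (P : pred I) (G : I -> E) :
  (forall i, P i -> 0 <= G i) -> 0 <= \sum_(i <- r | P i) G i.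
Proof.
by move=> G0; apply: (big_ind (fun z => 0 <= z)) => //; exact: rz_addr_ge0. Qed.

Lemma rz_ler_sum I (r : seq I) (P : pred I) (G H : I -> E) :
  (forall i, P i -> G i <= H i) ->
  \sum_(i <- r | P i) G i <= \sum_(i <- r | P i) H i.
Proof.
by move=> GH; apply: (big_ind2 (fun x y => x <= y)) => // *;
  exact: rz_lerD. Qed.

Lemma rz_lerN2 x y : (- x <= - y) = (y <= x).
Proof. by rewrite -[LHS]rz_subr_ge0 opprK addrC rz_subr_ge0. Qed.

Lemma rz_ler_scale a x y : 0 <= a -> x <= y -> a *: x <= a *: y.
Proof.
by move=> a0 xy; rewrite -rz_subr_ge0 -scalerBr riesz_scaler_ge0 ?rz_subr_ge0.
Qed.

Lemma rz_ler_scaler a b x : a <= b -> 0 <= x -> a *: x <= b *: x.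
Proof.
by move=> ab x0; rewrite -rz_subr_ge0 -scalerBl riesz_scaler_ge0 ?subr_ge0.
Qed.

Definition rz_pos x := riesz_join x 0.
Definition rz_neg x := rz_pos (- x).

Lemma rz_pos_ge0 x : 0 <= rz_pos x.
Proof. by have := riesz_leUx x 0 (rz_pos x); rewrite lexx => /esym/andP[]. Qed.

Lemma rz_le_pos x : x <= rz_pos x.
Proof. by have := riesz_leUx x 0 (rz_pos x); rewrite lexx => /esym/andP[]. Qed.

Lemma rz_pos_le x z : x <= z -> 0 <= z -> rz_pos x <= z.
Proof. by move=> xz z0; rewrite riesz_leUx xz. Qed.

Lemma rz_neg_ge0 x : 0 <= rz_neg x. Proof. exact: rz_pos_ge0. Qed.

Lemma rz_posBneg x : rz_pos x - rz_neg x = x.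
Proof.
(* The right side bounds both [y] and [0] from above. The cases [y = x] and [y = - x] give the two
   inequalities. *)
suff h y : rz_pos y <= y + rz_pos (- y).
  apply/eqP; rewrite subr_eq; apply/eqP/le_anti; rewrite h /=.
  have := riesz_lerD2r x _ _ (h (- x)); rewrite opprK.
  by rewrite addrAC addNr add0r addrC.
apply: rz_pos_le.
  by rewrite -{1}[y]addr0 rz_lerD // rz_pos_ge0.
by rewrite addrC -[X in _ + X]opprK rz_subr_ge0 rz_le_pos.
Qed.

Lemma rz_pos_id x : 0 <= x -> rz_pos x = x.
Proof. by move=> x0; apply/le_anti; rewrite rz_le_pos rz_pos_le. Qed.

Lemma rz_neg_id x : 0 <= x -> rz_neg x = 0.
Proof.
move=> x0; apply: (addrI (x - rz_neg x)).
by rewrite subrK addr0 -{2}(rz_pos_id x0) rz_posBneg. Qed.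

Hypothesis archE : riesz_archimedean E.

(** The archimedean property concerns nonnegative elements, so it is applied to the positive part of
    [x]: for positive [n], both [x] and [0] lie below [y / n], hence so does [rz_pos x]. *)
Lemma rz_arch_le0 x y : (forall n, x *+ n <= y) -> x <= 0.
Proof.
move=> xy; have y0 : 0 <= y by have := xy 0%N.
suff x0 : rz_pos x = 0 by rewrite -x0 rz_le_pos.
apply: (archE (y := y)) => [|[|n]]; rewrite ?rz_pos_ge0 ?mulr0n //.
rewrite -scaler_nat -[leRHS](scalerKV (a := n.+1%:R)) ?pnatr_eq0 //.
apply: rz_ler_scale => //; apply: rz_pos_le; last first.
  by apply: riesz_scaler_ge0 => //; rewrite invr_ge0.
rewrite -[leLHS](scalerK (a := n.+1%:R)) ?pnatr_eq0 //.
by apply: rz_ler_scale; rewrite ?invr_ge0 // scaler_nat.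
Qed.

(** Multiplication by [n + 1] gives [- x *+ n.+1 <= y] for every [n]; replacing [y] by its positive
    part covers the multiple [0]. *)
Lemma rz_ge0_approx x y : (forall n, 0 <= x + n.+1%:R^-1 *: y) -> 0 <= x.
Proof.
move=> xy; rewrite -[x]opprK -[0]oppr0 rz_lerN2.
have h n : - x *+ n.+1 <= y.
  rewrite mulNrn -rz_subr_ge0 opprK addrC -scaler_nat.
  rewrite -[X in _ + X](scalerKV (a := n.+1%:R)) ?pnatr_eq0 // -scalerDr.
  by apply: riesz_scaler_ge0.
apply: (rz_arch_le0 (y := rz_pos y)) => -[|n];
first by rewrite mulr0n rz_pos_ge0.
exact: le_trans (h n) (rz_le_pos y).
Qed.

End RieszOrder.

(** * Frechet's equation on a cone *)

Section Cone.
Variables (R : realType) (E : rieszType R) (W : lmodType R).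
Implicit Types (f : E -> W) (x : E).

(** Maps on the cone are represented by maps on all of [E], whose values off the cone are left
    unconstrained. *)
Definition fdiff_null n f :=
  forall x (h : 'I_n -> E), 0 <= x -> (forall i, 0 <= h i) -> fdiff f x h = 0.

Lemma eq_fdiff_cone n f g x (h : 'I_n -> E) :
  (forall y, 0 <= y -> f y = g y) -> 0 <= x -> (forall i, 0 <= h i) ->
  fdiff f x h = fdiff g x h.
Proof.
move=> fg x0 h0; apply: eq_bigr => d _; rewrite fg //.
by apply: rz_addr_ge0 => //; apply: rz_sumr_ge0 => i _; exact: rz_mulrn_ge0.
Qed.

Lemma fdiff_scale n f (a : R) x (h : 'I_n -> E) :
  fdiff f (a *: x) (fun i => a *: h i) = fdiff (fun y => f (a *: y)) x h.
Proof.
apply: eq_bigr => d _; rewrite scalerDr scaler_sumr.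
congr (f (_ + _) *~ _); apply: eq_bigr => i _.
by rewrite -!scaler_nat !scalerA mulrC.
Qed.

(* Djokovic's identity, arranged so that all increments stay in the cone: the
   factor of the product of differences belonging to [i] compares the increments
   [h i] and [j *: h i / (i + 1)], which coincide when [j = i + 1], so that only
   [j = 0] contributes. *)
Lemma fdiff_null_of_const n f :
  (forall x u, 0 <= x -> 0 <= u -> fdiff f x (fun _ : 'I_n => u) = 0) ->
  fdiff_null n f.
Proof.
move=> fc x h x0 h0.
pose v (e : {ffun 'I_n -> bool}) := \sum_(i < n) (i.+1%:R^-1 *: h i) *+ ~~ e i.
pose y (e : {ffun 'I_n -> bool}) := x + \sum_(i < n) h i *+ e i.
pose T (d e : {ffun 'I_n -> bool}) := f (y e + v e *+ \sum_(i < n) d i).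
(* For fixed [e], the inner sum is the difference at [y e] with all increments equal to [v e], which
   vanishes by hypothesis. *)
have T0 : \sum_e (\sum_d T d e *~ sgn d) *~ sgn e = 0.
  rewrite big1 // => e _; rewrite -[RHS](mul0rz _ (sgn e)); congr (_ *~ _).
  rewrite -[RHS](fc (y e) (v e)).
  - rewrite fdiffE; apply: eq_bigr => d _; congr (f (_ + _) *~ _).
    by rewrite -sumrMnr.
  - by rewrite rz_addr_ge0 // rz_sumr_ge0 // => i _; exact: rz_mulrn_ge0.
  - rewrite rz_sumr_ge0 // => i _; apply: rz_mulrn_ge0;
    apply: riesz_scaler_ge0 => //.
    by rewrite invr_ge0.
have : \sum_d (\sum_e T d e *~ sgn e) *~ sgn d = 0.
  rewrite -[RHS]T0; under eq_bigr do rewrite mulrz_suml.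
  rewrite exchange_big /=; apply: eq_bigr => e _.
  by rewrite mulrz_suml; apply: eq_bigr => d _; rewrite -!mulrzA mulrC.
rewrite (bigD1 [ffun=> false]) //= [X in _ + X]big1 => [|d dN0].
  rewrite addr0 sgn_const_false => /eqP.
  rewrite -[_ *~ _]scaler_int scaler_eq0 => /orP[/eqP|/eqP fx].
    by rewrite rmorphXn /= rmorphN1 => /eqP; rewrite signr_eq0.
  rewrite -[RHS]fx fdiffE; apply: eq_bigr => e _; congr (_ *~ _).
  by rewrite /T (eq_bigr (fun=> 0%N)) ?big1_eq ?mulr0n ?addr0 // => i _;
    rewrite ffunE.
(* The sum over [e] cancels in pairs along direction [j - 1]; [j] is positive because [d] is not
   constantly false. *)
pose j := (\sum_(i < n) d i)%N.
have j0 : (0 < j)%N.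
  rewrite lt0n sum_nat_eq0; apply: contra dN0 => /forallP d0.
  by apply/eqP/ffunP => i; rewrite ffunE; apply/negbTE; rewrite -eqb0;
    apply: d0.
have jn : (j.-1 < n)%N.
  rewrite prednK // -[leqRHS]card_ord -sum1_card; apply: leq_sum => i _.
  exact: leq_b1.
pose i := Ordinal jn.
rewrite (sum_sgn_split i) big1 ?mul0rz // => e ei.
suff -> : T d e = T d (toggle i e) by rewrite subrr mul0rz.
congr f; rewrite /y -!addrA; congr (x + _).
rewrite /v -!sumrMnl -!big_split /=; apply: eq_bigr => k _.
have [->|ki] := eqVneq k i; last by rewrite toggle_neq.
rewrite toggle_same ei /= mulr1n !mulr0n mul0rn add0r addr0 mulr1n.
by rewrite prednK // -/j -scaler_nat scalerKV // pnatr_eq0 -lt0n.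
Qed.

(** The two sides differ by an [(n + 1)]-th difference whose extra increment is [u]. *)
Lemma fdiff_null_shift n f x u (h : 'I_n -> E) :
  fdiff_null n.+1 f -> 0 <= x -> 0 <= u -> (forall i, 0 <= h i) ->
  fdiff f (x + u) h = fdiff f x h.
Proof.
move=> f0 x0 u0 h0; apply/eqP; rewrite -subr_eq0 fdiff_scons f0 // => i.
by case: insub.
Qed.

Lemma fdiff_nullS n f : fdiff_null n f -> fdiff_null n.+1 f.
Proof. by move=> f0 x h x0 h0; rewrite fdiffS !f0 ?subrr // rz_addr_ge0. Qed.

Lemma fdiff_null_le m n f : (m <= n)%N -> fdiff_null m f -> fdiff_null n f.
Proof.
move=> /subnK <- f0; elim: (n - m)%N => // k; rewrite addSn; exact: fdiff_nullS.
Qed.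

(** A step [u + v] in direction [i] is a step [u] followed by a step [v]: the difference telescopes,
    and is thus additive up to a shift of the base point. *)
Lemma fdiff_set_argD n f x (y : {ffun 'I_n -> E}) i u v :
  fdiff f x (set_arg y i (u + v)) =
  fdiff f (x + u) (set_arg y i v) + fdiff f x (set_arg y i u).
Proof.
have S d w : \sum_j set_arg y i w j *+ d j =
    w *+ d i + \sum_(j | j != i) y j *+ d j.
  rewrite (bigD1 i) //= ffunE eqxx; congr (_ + _).
  by apply: eq_bigr => j /negbTE ji; rewrite ffunE ji.
rewrite !fdiffE !(sum_sgn_split i) -big_split /=; apply: eq_bigr => d di.
rewrite !S toggle_same di !mulr1n !mulr0n !add0r -mulrzDl; congr (_ *~ _).
rewrite !addrA; set s := \sum_(j | _) _; set s' := \sum_(j | _) _.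
have -> : s' = s by apply: eq_bigr => j ji; rewrite toggle_neq.
by rewrite subrK.
Qed.

End Cone.

(** * Homogeneous decomposition on the cone *)

(** By the binomial formula, one difference of [t ^ j] leaves terms of degree [i < j], of which only
    [j * t ^ (j - 1)] can survive the remaining differences. *)
Lemma fdiff_monomial (R : comNzRingType) n j (x : R) : (j <= n)%N ->
  fdiff (fun t : R => t ^+ j : R^o) x (fun _ : 'I_n => 1) =
  (n`! * (j == n))%:R :> R^o.
Proof.
elim: n j x => [|n IH] j x.
  by rewrite leqn0 => /eqP->; rewrite fdiff0.
move=> jn; rewrite fdiffS_const.
have -> : (fun t : R => (t + 1) ^+ j - t ^+ j : R^o) =
    fun t => \sum_(i < j) 'C(j, i)%:R *: (t ^+ i : R^o).
  apply/funext => t;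
  rewrite [t + 1]addrC exprDn big_ord_recr /= subnn expr0 mul1r.
  rewrite binn mulr1n addrK; apply: eq_bigr => i _.
  by rewrite expr1n mul1r -mulr_natl.
rewrite fdiff_sum.
have le_in (i : 'I_j) : (i <= n)%N by rewrite -ltnS (leq_trans (ltn_ord i)).
under eq_bigr => i _ do rewrite fdiffZ IH //.
case: j jn {le_in} => [|j] jn; first by rewrite big_ord0 muln0.
rewrite eqSS; have [->|jn'] := eqVneq j n.
  rewrite big_ord_recr /= big1 => [|i _]; last first.
    by rewrite (ltn_eqF (ltn_ord i)) muln0 scaler0.
  by rewrite add0r eqxx !muln1 binSn factS natrM.
rewrite muln0 big1 // => i _; rewrite (ltn_eqF _) ?muln0 ?scaler0 //.
by rewrite (leq_trans (ltn_ord i)) // ltn_neqAle jn' -ltnS.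
Qed.

Section Decomposition.
Variables (R : realType) (E : rieszType R) (W : lmodType R).
Implicit Types (f q : E -> W) (x : E).

Definition cone_additive k (A : {ffun 'I_k -> E} -> W) :=
  forall (x : {ffun 'I_k -> E}) i u v,
  (forall j, 0 <= x j) -> 0 <= u -> 0 <= v ->
  A (set_arg x i (u + v)) = A (set_arg x i u) + A (set_arg x i v).

(** Stands in for [k]-homogeneous polynomials on the cone while only natural scalars are under
    control. *)
Definition cone_homogeneous k q :=
  (forall n x, 0 <= x -> q (n%:R *: x) = n%:R ^+ k *: q x) /\
  fdiff_null k.+1 q.

(** Polarization: when [f] is the diagonal of a symmetric [k]-linear map, this recovers that map. *)
Definition polar k f (x : {ffun 'I_k -> E}) : W := k`!%:R^-1 *: fdiff f 0 x.
Arguments polar k f x : clear implicits.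

Lemma set_arg_ge0 k (x : {ffun 'I_k -> E}) i u :
  (forall j, 0 <= x j) -> 0 <= u -> forall j, 0 <= set_arg x i u j.
Proof. by move=> x0 u0 j; rewrite ffunE; case: ifP. Qed.

Lemma set_arg_id k (x : {ffun 'I_k -> E}) i : set_arg x i (x i) = x.
Proof. by apply/ffunP => j; rewrite ffunE; case: eqP => [->|]. Qed.

Lemma cone_additive0 k (A : {ffun 'I_k -> E} -> W) (x : {ffun 'I_k -> E}) i :
  cone_additive A -> (forall j, 0 <= x j) -> A (set_arg x i 0) = 0.
Proof.
move=> Aadd x0; apply: (addrI (A (set_arg x i 0))).
by rewrite -Aadd ?addr0.
Qed.

Lemma cone_additive_nat k (A : {ffun 'I_k -> E} -> W)
    (x : {ffun 'I_k -> E}) i n u :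
  cone_additive A -> (forall j, 0 <= x j) -> 0 <= u ->
  A (set_arg x i (n%:R *: u)) = n%:R *: A (set_arg x i u).
Proof.
move=> Aadd x0 u0; elim: n => [|n IH]; first by rewrite !scale0r cone_additive0.
rewrite -[n.+1]addn1 natrD !scalerDl !scale1r Aadd ?IH // scaler_nat.
exact: rz_mulrn_ge0.
Qed.

Lemma scale_all_args k (A : {ffun 'I_k -> E} -> W) (a : R)
    (x : {ffun 'I_k -> E}) :
  0 <= a ->
  (forall (y : {ffun 'I_k -> E}) i (u : E), (forall j, 0 <= y j) -> 0 <= u ->
    A (set_arg y i (a *: u)) = a *: A (set_arg y i u)) ->
  (forall j, 0 <= x j) -> A [ffun i => a *: x i] = a ^+ k *: A x.
Proof.
move=> a0 Aa x0.
(* The first [p] arguments are scaled, so [y p] and [y p.+1] differ in a single argument. *)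
pose y (p : nat) : {ffun 'I_k -> E} :=
  [ffun i : 'I_k => if (i < p)%N then a *: x i else x i].
have y0 p j : 0 <= y p j.
  by rewrite ffunE; case: ifP => // _; exact: riesz_scaler_ge0.
have : forall p, (p <= k)%N -> A (y p) = a ^+ p *: A x.
  elim=> [_|p IH pk]; first by rewrite scale1r; congr A; apply/ffunP => i;
  rewrite ffunE.
  pose i := Ordinal pk.
  have -> : y p.+1 = set_arg (y p) i (a *: y p i).
    apply/ffunP => j; rewrite !ffunE /= ltnn ltnS leq_eqVlt -val_eqE /=.
    by case: eqP => //= jp; congr (a *: x _); exact: val_inj.
  by rewrite Aa // set_arg_id IH 1?ltnW // scalerA -exprS.
move/(_ k (leqnn k)) <-; congr A; apply/ffunP => i.
by rewrite !ffunE ltn_ord.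
Qed.

(** [fdiff_set_argD] gives additivity up to a shift of the base point, which is harmless once the
    next differences vanish. *)
Lemma polar_additive k f : fdiff_null k.+1 f -> cone_additive (polar k f).
Proof.
move=> f0 x i u v x0 u0 v0; rewrite /polar -scalerDr fdiff_set_argD addrC.
by rewrite fdiff_null_shift //; exact: set_arg_ge0.
Qed.

Lemma polar_symmetric k f (s : 'S_k) (x : {ffun 'I_k -> E}) :
  polar k f [ffun i => x (s i)] = polar k f x.
Proof.
rewrite /polar -(fdiff_perm f 0 x s); congr (_ *: _).
by apply: eq_fdiffh => i; rewrite ffunE.
Qed.

Lemma natfact_neq0 k : k`!%:R != 0 :> R.
Proof. by rewrite pnatr_eq0 -lt0n fact_gt0. Qed.

(** On natural multiples of [x], [q] behaves like [t ^ k] times [q x], and the [k]-th difference of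
    [t ^ k] with unit steps is [k!]. *)
Lemma fdiff_ray k q x :
  (forall n, q (n%:R *: x) = n%:R ^+ k *: q x) ->
  fdiff q 0 (fun _ : 'I_k => x) = k`!%:R *: q x.
Proof.
move=> qx.
have := @fdiff_monomial R k k 0 (leqnn k); rewrite eqxx muln1 => <-.
rewrite (fdiffE (R := R)) (fdiffE (R := R)) scaler_suml; apply: eq_bigr => d _.
rewrite !add0r !sumrMnr -scaler_nat qx.
by rewrite -scalerMzl.
Qed.

Lemma polar_diag k q x : cone_homogeneous k q -> 0 <= x ->
  polar k q [ffun=> x] = q x.
Proof.
move=> [qn _] x0; apply: (scalerI (natfact_neq0 k)).
rewrite -(@fdiff_ray k q) => [|n]; last exact: qn.
rewrite scalerA divff ?natfact_neq0 // scale1r.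
by apply: eq_fdiffh => i; rewrite ffunE.
Qed.

Lemma fdiff_null_dilation n (a : R) f :
  0 <= a -> fdiff_null n f -> fdiff_null n (fun x => f (a *: x)).
Proof.
move=> a0 f0 x h x0 h0; rewrite -fdiff_scale f0 //;
first exact: riesz_scaler_ge0.
by move=> i; exact: riesz_scaler_ge0.
Qed.

Lemma polar_homogeneous k f : fdiff_null k.+1 f ->
  cone_homogeneous k (fun x => polar k f [ffun=> x]).
Proof.
move=> f0; split=> [n x x0|].
  rewrite -scale_all_args // => [|y i u y0 u0|j]; last by rewrite ffunE.
    by congr (polar k f _); apply/ffunP => i; rewrite !ffunE.
  by rewrite cone_additive_nat //; exact: polar_additive.
(* The diagonal is a linear combination of dilations of [f] by natural numbers, each of which
   inherits the vanishing differences of [f]. *)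
have -> : (fun x => polar k f [ffun=> x]) = fun x =>
    \sum_(d : {ffun 'I_k -> bool})
      (k`!%:R^-1 * (sgn d)%:~R) *: f ((\sum_i d i)%N%:R *: x).
  apply/funext => x; rewrite /polar fdiffE scaler_sumr; apply: eq_bigr => d _.
  rewrite -scaler_int scalerA add0r; congr (_ *: f _).
  by rewrite scaler_nat -sumrMnr; apply: eq_bigr => i _; rewrite ffunE.
move=> x h x0 h0; rewrite (fdiff_sum (R := R)) big1 // => d _.
by rewrite fdiffZ fdiff_null_dilation ?scaler0.
Qed.

Lemma homogeneous_decomposition m f : fdiff_null m f ->
  exists2 Q : nat -> E -> W, (forall k, cone_homogeneous k (Q k)) &
    forall x, 0 <= x -> f x = \sum_(k < m) Q k x.
Proof.
elim: m f => [|m IH] f f0.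
  exists (fun _ _ => 0) => [k|x x0].
    split=> [n x x0|x h x0 h0]; first by rewrite scaler0.
    by rewrite fdiff_cst0.
  have := f0 x (fun=> 0) x0 (fun _ => lexx 0).
  by rewrite fdiff0 big_ord0.
pose q x := polar m f [ffun=> x].
have qh : cone_homogeneous m q by exact: polar_homogeneous.
have [|Q Qh fQ] := IH (fun x => f x - q x).
  (* The [(m + 1)]-th differences of [f - q] vanish, so the base point can be moved to [0], where
     the differences of [f] and [q] with all increments [u] both equal [m! q u]. *)
  apply: fdiff_null_of_const => x u x0 u0;
  rewrite -[x]add0r fdiff_null_shift //.
    rewrite (fdiffB (R := R)) [X in _ - X]fdiff_ray => [|n]; last exact: qh.1.
    rewrite scalerA divff ?natfact_neq0 // scale1r; apply/eqP; rewrite subr_eq0.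
    by apply/eqP/eq_fdiffh => i; rewrite ffunE.
  move=> y h y0 h0; rewrite (fdiffB (R := R)) f0 // qh.2 // subr0 //.
exists (fun k => if k == m then q else Q k) => [k|x x0].
  by case: eqP => // ->.
rewrite big_ord_recr /= eqxx.
under eq_bigr => i _ do rewrite (ltn_eqF (ltn_ord i)).
by rewrite -fQ // subrK.
Qed.

Lemma cone_homogeneous_inv k q n x : cone_homogeneous k q -> 0 <= x ->
  q (n.+1%:R^-1 *: x) = n.+1%:R^-1 ^+ k *: q x.
Proof.
move=> [qn _] x0; have n0 : n.+1%:R != 0 :> R by rewrite pnatr_eq0.
have y0 : 0 <= n.+1%:R^-1 *: x by apply: riesz_scaler_ge0; rewrite ?invr_ge0.
rewrite -[in RHS](scalerKV n0 x) qn // scalerA -exprMn mulVf // expr1n.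
by rewrite scale1r.
Qed.

End Decomposition.

Arguments polar {R E W} k f x.

(** * Positive additive maps on the cone *)

Section Extension.
Variables (R : realType) (E F : rieszType R).

Lemma fdiff_component_ge0 m (f : E -> F) (Q : nat -> E -> F) k :
  riesz_archimedean F ->
  (forall j, cone_homogeneous j (Q j)) ->
  (forall x, 0 <= x -> f x = \sum_(j < m) Q j x) ->
  (forall h : 'I_k -> E, (forall i, 0 <= h i) -> 0 <= fdiff f 0 h) ->
  (k < m)%N ->
  forall h : 'I_k -> E, (forall i, 0 <= h i) -> 0 <= fdiff (Q k) 0 h.
Proof.
move=> archF Qh fQ f_ge0 km h h0.
pose b j := fdiff (Q j) 0 h.
have b0 j : (j < k)%N -> b j = 0.
  by move=> jk; apply: (fdiff_null_le jk (Qh j).2).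
(* The error bound must not depend on [n]: the sum of the positive parts of all the [b j] serves. *)
apply: (rz_ge0_approx archF (y := \sum_(j < m) rz_pos (b j))) => n.
pose a : R := n.+1%:R^-1.
have a0 : 0 < a by rewrite invr_gt0.
have a1 : a <= 1 by rewrite invf_le1 // ler1n.
have ah0 i : 0 <= a *: h i by apply: riesz_scaler_ge0 => //; exact: ltW.
have fa : fdiff f 0 (fun i => a *: h i) = \sum_(j < m) a ^+ j *: b j.
  rewrite (eq_fdiff_cone (g := fun x => \sum_(j < m) Q j x)) //.
  rewrite (fdiff_sum (R := R)); apply: eq_bigr => j _.
  rewrite -[X in fdiff _ X](scaler0 _ a) fdiff_scale -fdiffZ.
  by apply: eq_fdiff_cone => // x x0; exact: cone_homogeneous_inv.
have ak0 : 0 <= a ^- k by rewrite invr_ge0 exprn_ge0 // ltW.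
have := f_ge0 _ ah0; rewrite fa => /(riesz_scaler_ge0 _ _ ak0) /le_trans; apply.
rewrite -/a !scaler_sumr [leLHS](bigD1 (Ordinal km)) //=.
rewrite [X in _ <= _ + X](bigD1 (Ordinal km)) //= addrA.
apply: rz_lerD.
  rewrite scalerA mulVf ?expf_neq0 ?gt_eqF // scale1r.
  rewrite -{1}[b k]addr0; apply: rz_lerD => //.
  by apply: riesz_scaler_ge0; [exact: ltW|exact: rz_pos_ge0].
(* After division by [a ^ k], degrees below [k] contribute zero, and those above carry
   [a ^ (j - k)], at most [a] because [a <= 1]. *)
apply: rz_ler_sum => j jk; have [jk'|kj|jk'] := ltngtP j k.
- by rewrite b0 // !scaler0 riesz_scaler_ge0 ?rz_pos_ge0 ?ltW.
- rewrite scalerA -(subnK (ltnW kj)) exprD mulrCA mulVf ?expf_neq0 ?gt_eqF //.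
  rewrite mulr1 subnK ?(ltnW kj) //.
  apply: (@le_trans _ _ (a ^+ (j - k) *: rz_pos (b j))).
    by apply: rz_ler_scale; [exact/exprn_ge0/ltW|exact: rz_le_pos].
  apply: rz_ler_scaler; last exact: rz_pos_ge0.
  rewrite -[leRHS]expr1; apply: ler_wiXn2l;
  rewrite ?subn_gt0 ?(ltW a0) ?a1 ?kj //.
- by move: jk; rewrite -val_eqE /= jk' eqxx.
Qed.

(** * Positive additive maps of one variable *)

Section OneVariable.
Variable phi : E -> F.
Hypothesis archF : riesz_archimedean F.
Hypothesis phiD : forall u v, 0 <= u -> 0 <= v -> phi (u + v) = phi u + phi v.
Hypothesis phi_ge0 : forall u, 0 <= u -> 0 <= phi u.

Lemma additive_le u v : 0 <= u -> u <= v -> phi u <= phi v.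
Proof.
move=> u0 uv; rewrite -(subrK u v) phiD ?rz_subr_ge0 //.
by rewrite -{1}[phi u]add0r; apply: riesz_lerD2r; rewrite phi_ge0 ?rz_subr_ge0.
Qed.

Lemma additive_natZ n u : 0 <= u -> phi (n%:R *: u) = n%:R *: phi u.
Proof.
move=> u0; elim: n => [|n IH].
  by rewrite !scale0r; apply: (addrI (phi 0)); rewrite -phiD ?addr0.
rewrite -[n.+1]addn1 natrD !scalerDl !scale1r phiD ?IH //.
exact: riesz_scaler_ge0.
Qed.

(** With [p] the integer part of [n * a], monotonicity puts [n] times either side between [p] and
    [p + 1] times [phi u]. So [n] times their difference stays below [phi u] for all [n], and [F] is
    archimedean. *)
Lemma additive_scale (a : R) u : 0 <= a -> 0 <= u -> phi (a *: u) = a *: phi u.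
Proof.
move=> a0 u0; have pu0 := phi_ge0 u0.
have au0 : 0 <= a *: u by exact: riesz_scaler_ge0.
have bounds n : exists p : nat,
    [/\ p%:R *: phi u <= n%:R *: phi (a *: u) <= p.+1%:R *: phi u &
        p%:R *: phi u <= n%:R *: (a *: phi u) <= p.+1%:R *: phi u].
  have na0 : 0 <= n%:R * a by exact: mulr_ge0.
  have /andP[pl pr] := truncn_itv na0; set p := Num.trunc _ in pl pr.
  have nE x (v : E) : 0 <= x -> 0 <= v -> 0 <= x *: v :=
    @riesz_scaler_ge0 R E x v.
  exists p; split; last by rewrite scalerA !rz_ler_scaler // ltW.
  by rewrite -!additive_natZ // scalerA !additive_le ?nE // rz_ler_scaler // ltW.
have diff_le0 x y : (forall n : nat, exists p : nat,
    x *+ n <= p.+1%:R *: phi u /\ p%:R *: phi u <= y *+ n) -> x <= y.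
  move=> h; rewrite -rz_subr_ge0 -opprB -[0]oppr0 rz_lerN2.
  apply: (rz_arch_le0 archF (y := phi u)) => n; rewrite mulrnBl.
  have [p [xp py]] := h n;
  apply: (le_trans (y := p.+1%:R *: phi u - p%:R *: phi u)).
    by apply: rz_lerD => //; rewrite rz_lerN2.
  by rewrite -scalerBl -natrB // subSnn scale1r.
by apply/le_anti/andP; split; apply: diff_le0 => n; have [p] := bounds n;
  rewrite !scaler_nat => -[/andP[h1 h2] /andP[h3 h4]]; exists p;
  rewrite !scaler_nat.
Qed.

Definition cone_ext1 w := phi (rz_pos w) - phi (rz_neg w).

(** The extension is independent of how [w] is written as a difference of cone elements: [phi] is
    applied to [u + rz_neg w = rz_pos w + v]. *)
Lemma cone_ext1B u v : 0 <= u -> 0 <= v -> cone_ext1 (u - v) = phi u - phi v.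
Proof.
move=> u0 v0; set w := u - v; apply/eqP.
rewrite subr_eq addrAC eq_sym subr_eq -!phiD ?rz_pos_ge0 ?rz_neg_ge0 //.
have -> : u + rz_neg w = u - v + v + rz_neg w by rewrite subrK.
by rewrite -/w -{1}[w]rz_posBneg addrAC subrK.
Qed.

Lemma cone_ext1_linear (a : R) w z :
  cone_ext1 (a *: w + z) = a *: cone_ext1 w + cone_ext1 z.
Proof.
have scaled (b : R) u : 0 <= b -> 0 <= u -> 0 <= b *: u :=
  @riesz_scaler_ge0 R E b u.
have [a0|/ltW a0] := lerP 0 a.
  have -> : a *: w + z =
      (a *: rz_pos w + rz_pos z) - (a *: rz_neg w + rz_neg z).
    by rewrite opprD addrACA -scalerBr !rz_posBneg.
  rewrite cone_ext1B ?rz_addr_ge0 ?scaled ?rz_pos_ge0 ?rz_neg_ge0 //.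
  rewrite !phiD ?scaled ?rz_pos_ge0 ?rz_neg_ge0 //
    !additive_scale ?rz_pos_ge0 ?rz_neg_ge0 //.
  by rewrite opprD addrACA -scalerBr.
(* For negative [a], the positive and negative parts of [w] exchange roles under scaling by
   [- a]. *)
have Na0 : 0 <= - a by rewrite oppr_ge0.
have -> : a *: w + z =
    ((- a) *: rz_neg w + rz_pos z) - ((- a) *: rz_pos w + rz_neg z).
  by rewrite opprD addrACA -scalerBr -{1}[w]rz_posBneg
    -opprB scalerN scaleNr rz_posBneg.
rewrite cone_ext1B ?rz_addr_ge0 ?scaled ?rz_pos_ge0 ?rz_neg_ge0 //.
rewrite !phiD ?scaled ?rz_pos_ge0 ?rz_neg_ge0 //
    !additive_scale ?rz_pos_ge0 ?rz_neg_ge0 //.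
by rewrite opprD addrACA -scalerBr -opprB scalerN scaleNr opprK.
Qed.

End OneVariable.

(** * Extension in several variables *)

Definition signed_parts k (d : {ffun 'I_k -> bool}) (x : {ffun 'I_k -> E}) :=
  [ffun i => if d i then rz_pos (x i) else rz_neg (x i)].

(** The multilinear expansion of [A] after writing each argument as its positive part minus its
    negative part; [sgn d] counts the negative parts chosen. *)
Definition cone_ext k (A : {ffun 'I_k -> E} -> F) (x : {ffun 'I_k -> E}) : F :=
  \sum_d A (signed_parts d x) *~ sgn d.

Lemma signed_parts_ge0 k (d : {ffun 'I_k -> bool}) x i :
  0 <= signed_parts d x i.
Proof. by rewrite ffunE; case: ifP; rewrite ?rz_pos_ge0 ?rz_neg_ge0. Qed.

Section SeveralVariables.
Variables (k : nat) (A : {ffun 'I_k -> E} -> F).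
Hypothesis archF : riesz_archimedean F.
Hypothesis Aadd : cone_additive A.
Hypothesis A_ge0 :
  forall x : {ffun 'I_k -> E}, (forall i, 0 <= x i) -> 0 <= A x.

(** Pairing the vertices along direction [i] turns the dependence on argument [i] into a sum of
    one-variable extensions [cone_ext1], which are linear. *)
Lemma cone_ext_multilinear : multilinear (cone_ext A).
Proof.
move=> x i a u v; rewrite /cone_ext !(sum_sgn_split i).
pose phi (d : {ffun 'I_k -> bool}) w := A (set_arg (signed_parts d x) i w).
have sp (d : {ffun 'I_k -> bool}) w : d i ->
    A (signed_parts d (set_arg x i w)) -
    A (signed_parts (toggle i d) (set_arg x i w)) = cone_ext1 (phi d) w.
  move=> di; congr (A _ - A _); apply/ffunP => j; rewrite !ffunE.
    by case: eqP => // ->; rewrite di.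
  by case: eqP => // ->; rewrite di.
rewrite scaler_sumr -big_split /=; apply: eq_bigr => d di.
rewrite !sp // cone_ext1_linear //.
- by rewrite mulrzDl scalerMzr.
- by move=> u' v' u0 v0; apply: Aadd => // j; exact: signed_parts_ge0.
- by move=> u' u0; apply/A_ge0/set_arg_ge0 => // j; exact: signed_parts_ge0.
Qed.

Lemma cone_extE (x : {ffun 'I_k -> E}) :
  (forall i, 0 <= x i) -> cone_ext A x = A x.
Proof.
move=> x0; rewrite /cone_ext (bigD1 [ffun=> true]) //= big1 => [|d dN1].
  rewrite addr0 (_ : sgn _ = 1) ?mulr1z.
    by congr A; apply/ffunP => i; rewrite !ffunE rz_pos_id.
  by rewrite /sgn big1 // => i _; rewrite ffunE.
(* A vertex that selects some negative part puts [0] into an argument of [A]. *)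
have [i di] : exists i, ~~ d i.
  apply/existsP; rewrite -negb_forall; apply: contra dN1 => /forallP d1.
  by apply/eqP/ffunP => i; rewrite ffunE d1.
rewrite -[signed_parts d x](set_arg_id _ i)
  [X in set_arg _ _ X]ffunE (negbTE di).
rewrite rz_neg_id // cone_additive0 ?mul0rz // => j.
exact: signed_parts_ge0.
Qed.

Lemma cone_ext_symmetric : symmetric_map A -> symmetric_map (cone_ext A).
Proof.
move=> Asym s x; rewrite /cone_ext.
pose t (u : 'S_k) (d : {ffun 'I_k -> bool}) := [ffun i => d (u i)].
have tK : cancel (t s) (t s^-1%g).
  by move=> d; apply/ffunP => i; rewrite !ffunE permKV.
rewrite [LHS](reindex_inj (can_inj tK)) /=; apply: eq_bigr => d _;
congr (_ *~ _).
  by rewrite -[RHS](Asym s); congr A; apply/ffunP => i; rewrite !ffunE.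
by rewrite /sgn [RHS](reindex_inj (@perm_inj _ s)); apply: eq_bigr => i _;
  rewrite ffunE.
Qed.

End SeveralVariables.

End Extension.

(** * Uniqueness *)

Section Uniqueness.
Variables (R : realType) (E F : rieszType R).

(** Along a line, [A] is a polynomial in [t] with coefficients in [F]; the arguments are expanded
    one at a time. *)
Lemma multilinear_line k (A : {ffun 'I_k -> E} -> F) (y z : {ffun 'I_k -> E}) :
  multilinear A -> exists c : nat -> F, forall t : R,
    A [ffun i => y i + t *: z i] = \sum_(j < k.+1) t ^+ j *: c j.
Proof.
move=> Alin.
pose yz p (y : {ffun 'I_k -> E}) t : {ffun 'I_k -> E} :=
  [ffun i : 'I_k => if (i < p)%N then y i + t *: z i else y i].
suff h p : (p <= k)%N -> forall y, exists c : nat -> F, forall t : R,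
    A (yz p y t) = \sum_(j < p.+1) t ^+ j *: c j.
  have [c yc] := h k (leqnn k) y; exists c => t; rewrite -yc; congr A.
  by apply/ffunP => i; rewrite !ffunE ltn_ord.
elim: p {y} => [_ y|p IH pk y].
  exists (fun=> A y) => t; rewrite big_ord1 expr0 scale1r.
  by congr A; apply/ffunP => i; rewrite ffunE.
pose i := Ordinal pk.
have [c yc] := IH (ltnW pk) y.
have [c' yc'] := IH (ltnW pk) (set_arg y i (z i)).
(* The summand with [z i] gains a factor [t], hence the index shift in [c']; [c] is cut off because
   its values beyond [p] are arbitrary. *)
exists (fun j => (if (j < p.+1)%N then c j else 0) +
                (if j is j'.+1 then c' j' else 0)).
move=> t; have -> : yz p.+1 y t = set_arg (yz p y t) i (t *: z i + y i).
  apply/ffunP => j; rewrite !ffunE ltnS leq_eqVlt -val_eqE /=.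
  by case: eqP => //= jp; rewrite addrC (_ : j = i) //; exact: val_inj.
rewrite Alin.
have -> : set_arg (yz p y t) i (y i) = yz p y t.
  by apply/ffunP => j; rewrite !ffunE; case: eqP => // ->; rewrite /= ltnn.
have -> : set_arg (yz p y t) i (z i) = yz p (set_arg y i (z i)) t.
  apply/ffunP => j; rewrite !ffunE; case: eqP => // ->; rewrite /= ltnn //.
rewrite yc yc' addrC.
under [RHS]eq_bigr do rewrite scalerDr.
rewrite big_split /=; congr (_ + _).
  rewrite [RHS]big_ord_recr /= ltnn scaler0 addr0; apply: eq_bigr => j _.
  by rewrite ltn_ord.
rewrite [RHS]big_ord_recl /= scaler0 add0r scaler_sumr; apply: eq_bigr => j _.
by rewrite scalerA -exprS.
Qed.

Lemma fdiff_scalel n (g : R -> R) (c : F) x (h : 'I_n -> R) :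
  fdiff (fun t => g t *: c) x h = fdiff (g : R -> R^o) x h *: c.
Proof.
by rewrite /fdiff scaler_suml; apply: eq_bigr => d _; rewrite scalerMzl. Qed.

Lemma positive_poly_line m (P : E -> F) u v x : positive_poly m P ->
  fdiff (fun t : R => P (u + t *: v)) x (fun _ : 'I_m.+1 => 1) = 0.
Proof.
move=> [Q [[_ PQ] Qpos]].
have Qline (k : 'I_m.+1) : exists c : nat -> F, forall t : R,
    Q k (u + t *: v) = \sum_(j < k.+1) t ^+ j *: c j.
  have [A [Alin _ AQ _]] := Qpos k.
  have [c Ac] := multilinear_line [ffun=> u] [ffun=> v] Alin.
  exists c => t; rewrite AQ -Ac; congr A.
  by apply/ffunP => i; rewrite !ffunE.
rewrite (_ : (fun t => _) = fun t =>
    \sum_(k < m.+1) Q k (u + t *: v)); last first.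
  by apply/funext.
rewrite (fdiff_sum (R := R)) big1 // => k _; have [c Qc] := Qline k.
rewrite (_ : (fun t => _) = fun t => \sum_(j < k.+1) t ^+ j *: c j); last first.
  by apply/funext.
rewrite (fdiff_sum (R := R)) big1 // => j _; rewrite fdiff_scalel.
have jm : (j < m.+1)%N := leq_trans (ltn_ord j) (ltn_ord k).
by rewrite fdiff_monomial ?(ltnW jm) // (ltn_eqF jm) muln0 scale0r.
Qed.

(* For [x = u - v] with [u, v >= 0], all the points [u + t *: v] with
   [t = 0, 1, ...] lie in the cone, and the difference equation along this line
   determines the value at [t = -1] from those. *)
Lemma positive_poly_unique m (P P' : E -> F) :
  positive_poly m P -> positive_poly m P' ->
  (forall x, 0 <= x -> P x = P' x) -> P = P'.
Proof.
move=> Pp Pp' PP'; apply/funext => x.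
pose u := rz_pos x; pose v := rz_neg x.
pose D (t : R) := P (u + t *: v) - P' (u + t *: v).
have D0 t : 0 <= t -> D t = 0.
  move=> t0; apply/eqP; rewrite subr_eq0 PP' // rz_addr_ge0 ?rz_pos_ge0 //.
  by rewrite riesz_scaler_ge0 ?rz_neg_ge0.
have : fdiff D (-1) (fun _ : 'I_m.+1 => 1) = 0.
  by rewrite (fdiffB (R := R)) !positive_poly_line // subrr.
(* The all-false vertex is [t = -1], where [u + t *: v] is [x]. *)
rewrite (fdiffE (R := R)) (bigD1 [ffun=> false]) //= [X in _ + X]big1
  => [|d dN0].
  rewrite addr0 sgn_const_false -scaler_int => /eqP.
  rewrite scaler_eq0 rmorphXn /= rmorphN1 signr_eq0 /= big1
    => [|i _]; last first.
    by rewrite ffunE.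
  by rewrite addr0 subr_eq0 scaleN1r rz_posBneg => /eqP.
(* At any other vertex at least one unit step is taken, so [t >= 0] and [D] vanishes. *)
have [i di] : exists i, d i.
  apply/existsP; apply: contraNT dN0; rewrite negb_exists => /forallP d0.
  by apply/eqP/ffunP => i; rewrite ffunE; apply/negbTE.
rewrite D0 ?mul0rz // (bigD1 i) //= di mulr1n addKr; apply: sumr_ge0 => j _.
exact: mulrn_wge0.
Qed.

End Uniqueness.

(** * Transfer to the positive cones and conclusion *)

Lemma fdiff_pos_cone (R : realType) (E F : rieszType R)
    (f : pos_cone E -> pos_cone F) n (x : pos_cone E) (h : 'I_n -> pos_cone E) :
  fdiff (fun y => val (f (insubd (0 : pos_cone E) y))) (val x)
    (fun i => val (h i)) =
  fdiff (fun y => val (f y)) x h.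
Proof.
apply: eq_bigr => d _; congr (val (f _) *~ _).
rewrite -[RHS](valKd (0 : pos_cone E)); congr insubd.
by rewrite raddfD raddf_sum; congr (_ + _); apply: eq_bigr => i _;
  rewrite raddfMn.
Qed.

Theorem proposition4 (R : realType) (E F : rieszType R)
  (archE : riesz_archimedean E) (archF : riesz_archimedean F)
  (m : nat) (m_gt0 : (0 < m)%N)
  (f : pos_cone E -> pos_cone F)
  (diff_eq0 : forall x h : pos_cone E,
     fdiff (fun y => val (f y)) x (fun _ : 'I_m.+1 => h) = 0)
  (diff_ge0 : forall (k : nat) (x : pos_cone E) (h : 'I_k -> pos_cone E),
     (1 <= k <= m)%N -> 0 <= fdiff (fun y => val (f y)) x h) :
  exists! P : E -> F,
    positive_poly m P /\ (forall x : pos_cone E, P (val x) = val (f x)).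
Proof.
(* Off the cone, [g] takes the default value of [f] at [0], which no difference taken within the
   cone sees. *)
pose g (y : E) : F := val (f (insubd (0 : pos_cone E) y)).
have gE n (x : E) (h : 'I_n -> E) (x0 : 0 <= x) (h0 : forall i, 0 <= h i) :
    fdiff g x h =
    fdiff (fun y => val (f y)) (PosCone x0) (fun i => PosCone (h0 i)).
  by rewrite -fdiff_pos_cone.
have g0 : fdiff_null m.+1 g.
  by apply: fdiff_null_of_const => x u x0 u0; rewrite (gE _ _ _ x0 (fun=> u0)).
have [Q Qh gQ] := homogeneous_decomposition g0.
have polar_ge0 (k : 'I_m.+1) (x : {ffun 'I_k -> E}) :
    (forall i, 0 <= x i) -> 0 <= polar k (Q k) x.
  move=> x0; apply: riesz_scaler_ge0; first by rewrite invr_ge0.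
  apply: (fdiff_component_ge0 archF Qh gQ) => // h h0.
  (* For [k = 0], nonnegativity comes from [f] having values in the cone of [F], since [diff_ge0]
     starts at [k = 1]. *)
  rewrite (gE _ _ _ (lexx 0) h0); case: (posnP k) => [k0|k1].
    by case: k k0 {x x0} h h0 => -[|//] i _ h h0; rewrite fdiff0;
      exact: pos_cone_valP.
  by apply: diff_ge0; rewrite k1 -ltnS ltn_ord.
pose P x := \sum_(k < m.+1) cone_ext (polar k (Q k)) [ffun=> x].
have Qadd (k : 'I_m.+1) := polar_additive (Qh k).2.
have Pk (k : 'I_m.+1) :
    positive_homogeneous_poly k
      (fun x : E => cone_ext (polar k (Q k)) [ffun=> x]).
  exists (cone_ext (polar k (Q k))); split => //.
  - exact: (cone_ext_multilinear archF (Qadd k) (polar_ge0 k)).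
  - by apply: cone_ext_symmetric => s x; exact: polar_symmetric.
  - by move=> x x0; rewrite cone_extE //; exact: polar_ge0.
have Pp : positive_poly m P.
  exists (fun k x => cone_ext (polar k (Q k)) [ffun=> x]); split=> //;
  split=> // k.
  by have [A [Alin _ AP _]] := Pk k; exists A.
have Pg x : 0 <= x -> P x = g x.
  move=> x0; rewrite gQ //; apply: eq_bigr => k _.
  by rewrite cone_extE ?polar_diag // => i; rewrite ffunE.
exists P; split=> [|P' [Pp' P'f]].
  split=> // x; rewrite Pg; last exact: pos_cone_valP.
  by rewrite /g [insubd _ _](valKd 0 x).
apply: (positive_poly_unique Pp Pp') => x x0.
rewrite Pg // [RHS](P'f (PosCone x0)) /g; congr (val (f _)).
exact: (valKd _ (PosCone x0)).
Qed.
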